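(* Let $\cong$ be a congruence on LTSs such that $L\doteq L'$ implies $L\cong L'$, and $\cong$ preserves $\mathit{Sf}$ and $\mathit{minD}$ but does not preserve $\mathit{Tr}$. Then $\cong$ is the equivalence induced by $\Sigma$, $\mathit{Sf}$, $\mathit{minD}$ and $\mathit{anI}$.
   Context: An LTS is a tuple $L=(S,\Sigma,\Delta,\hat s)$ with states $S$, alphabet $\Sigma$ (possibly infinite), $\tau\notin\Sigma$ a reserved invisible action, transitions $\Delta\subseteq S\times(\Sigma\cup\{\tau\})\times S$, initial state $\hat s$; $\Sigma(L)$ denotes the alphabet. Operators: action prefix $a.L$ ($a\neq\tau$): new initial state $\hat s'$, alphabet $\Sigma\cup\{a\}$, transitions $\Delta\cup\{(\hat s',a,\hat s)\}$. Hiding $L\setminus A$: alphabet $\Sigma\setminus A$, each transition labelled by an element of $A$ relabelled $\tau$, otherwise unchanged. Relational renaming $L\Phi$ ($\Phi$ a set of pairs, $\tau$ not in its domain $\mathcal D(\Phi)$ or range; $\Phi(a,b)$ means $(a,b)\in\Phi$ or $a=b\notin\mathcal D(\Phi)$): alphabet $\{b\mid\exists a\in\Sigma:\Phi(a,b)\}$, transitions $\{(s,b,s')\mid\exists a:(s,a,s')\in\Delta\wedge\Phi(a,b)\}$, same states and initial state. Parallel composition $L_1\|L_2$: states $S_1\times S_2$, alphabet $\Sigma_1\cup\Sigma_2$, initial $(\hat s_1,\hat s_2)$; actions in $\Sigma_1\cap\Sigma_2$ are taken jointly by both components, all other actions (including $\tau$) by one component while the other stays put. A congruence is an equivalence $\cong$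 with $L\cong L'\Rightarrow a.L\cong a.L',\ L\setminus A\cong L'\setminus A,\ L\Phi\cong L'\Phi,\ L\|L''\cong L'\|L'',\ L''\|L\cong L''\|L'$. For $\sigma=a_1\cdots a_n\in\Sigma^*$, $s\stackrel{\sigma}{\Rightarrow}s'$ means a finite path from $s$ to $s'$ whose non-$\tau$ labels are exactly $a_1,\dots,a_n$ in order; $\hat s\stackrel{\xi}{\Rightarrow}$ for $\xi\in\Sigma^\omega$ means an infinite path from $\hat s$ whose non-$\tau$ label sequence is $\xi$; $s\stackrel{\tau^\omega}{\to}$ means an infinite path of $\tau$-transitions from $s$. Define $\mathit{Tr}(L)=\{\sigma\in\Sigma^*\mid\exists s:\hat s\stackrel\sigma\Rightarrow s\}$, $\mathit{Div}(L)=\{\sigma\in\Sigma^*\mid\exists s:\hat s\stackrel\sigma\Rightarrow s\wedge s\stackrel{\tau^\omega}\to\}$, $\mathit{Inf}(L)=\{\xi\in\Sigma^\omega\mid\hat s\stackrel\xi\Rightarrow\}$, $\mathit{Sf}(L)=\{(\sigma,A)\in\Sigma^*\times2^\Sigma\mid\exists s:\hat s\stackrel\sigma\Rightarrow s\wedge\forall a\in A\cup\{\tau\}\,\forall s':(s,a,s')\notin\Delta\}$. Further $\mathit{minD}(L)=\{a_1\cdots a_n\in\mathit{Div}(L)\mid\forall i,0\le i<n: a_1\cdots a_i\notin\mathit{Div}(L)\}$, $\mathit{extI}(L)=\{a_1a_2\cdots\in\Sigma(L)^\omega\mid\exists i\ge0: a_1\cdots a_i\in\mathit{minD}(L)\}$,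 and $\mathit{anI}(L)=\mathit{Inf}(L)\setminus\mathit{extI}(L)$. $L\doteq L'$ (CFFD-equivalence) iff $\Sigma,\mathit{Sf},\mathit{Div},\mathit{Inf}$ all agree on $L$ and $L'$. An equivalence preserves $X$ if $L\cong L'\Rightarrow X(L)=X(L')$; the equivalence induced by $\Sigma,X_1,\dots,X_k$ relates $L,L'$ iff all these functions agree on them. *)

(* Defs.v *)
From mathcomp Require Import all_boot.
From mathcomp Require Import boolp classical_sets cardinality.

Set Implicit Arguments.
Unset Strict Implicit.
Unset Printing Implicit Defensive.

Local Open Scope classical_set_scope.

(* [Act] is the universe of visible actions, and alphabets are arbitrary subsets
   of it.  A label is an [option Act]; [None] is the invisible action tau, so
   tau is never in an alphabet.  States may form an arbitrary type. *)
Record LTS (Act : Type) : Type := MkLTS {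
  state : Type;
  alphabet : set Act;
  trans : state -> option Act -> state -> Prop;
  init : state;
  trans_alphabet : forall s a s', trans s (Some a) s' -> alphabet a
}.

Section Operators.
Variable Act : Type.
Implicit Types (L : LTS Act) (a b : Act) (l : option Act).

(* [None] is the new initial state. *)
Definition prefix_trans a L (s : option (state L)) l (s' : option (state L)) : Prop :=
  match s, s' with
  | Some t, Some t' => trans t l t'
  | None, Some t' => l = Some a /\ t' = init L
  | _, None => False
  end.

Lemma prefix_alphabet a L s b s' :
  @prefix_trans a L s (Some b) s' -> (alphabet L `|` [set a]) b.
Proof.
case: s s' => [t|] [t'|] //=; first by move=> h; left; apply: trans_alphabet h.
by move=> [[->] _]; right.
Qed.

Definition act_prefix a L : LTS Act :=
  {| init := None; trans_alphabet := @prefix_alphabet a L |}.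

Definition hide_trans (A : set Act) L (s : state L) l (s' : state L) : Prop :=
  match l with
  | Some b => ~ A b /\ trans s (Some b) s'
  | None => trans s None s' \/ exists2 a, A a & trans s (Some a) s'
  end.

Lemma hide_alphabet (A : set Act) L s b s' :
  @hide_trans A L s (Some b) s' -> (alphabet L `\` A) b.
Proof. by move=> [nAb h]; split=> //; apply: trans_alphabet h. Qed.

Definition hide L (A : set Act) : LTS Act :=
  {| init := init L; trans_alphabet := @hide_alphabet A L |}.

Definition rename_dom (Phi : set (Act * Act)) : set Act :=
  [set a | exists b, Phi (a, b)].

Definition renames (Phi : set (Act * Act)) a b : Prop :=
  Phi (a, b) \/ (a = b /\ ~ rename_dom Phi a).

(* tau is neither in the domain nor in the range of [Phi], so it is renamed to
   itself only. *)
Definition rename_trans (Phi : set (Act * Act)) L (s : state L) l (s' : state L) : Prop :=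
  match l with
  | Some b => exists2 a, trans s (Some a) s' & renames Phi a b
  | None => trans s None s'
  end.

Lemma rename_alphabet (Phi : set (Act * Act)) L s b s' :
  @rename_trans Phi L s (Some b) s' ->
  [set c | exists2 a, alphabet L a & renames Phi a c] b.
Proof. by move=> [a h ab]; exists a => //; apply: trans_alphabet h. Qed.

Definition rename L (Phi : set (Act * Act)) : LTS Act :=
  {| init := init L; trans_alphabet := @rename_alphabet Phi L |}.

Definition may_move_alone L2 l : Prop :=
  match l with Some a => ~ alphabet L2 a | None => True end.

Definition par_trans L1 L2 (s : state L1 * state L2) l (s' : state L1 * state L2) : Prop :=
  [\/ exists a, [/\ l = Some a, alphabet L1 a, alphabet L2 a,
                    trans s.1 (Some a) s'.1 & trans s.2 (Some a) s'.2],
      [/\ may_move_alone L2 l, trans s.1 l s'.1 & s'.2 = s.2]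
    | [/\ may_move_alone L1 l, trans s.2 l s'.2 & s'.1 = s.1]].

Lemma par_alphabet L1 L2 s b s' :
  @par_trans L1 L2 s (Some b) s' -> (alphabet L1 `|` alphabet L2) b.
Proof.
case=> [[a [[->] La _ _ _]]|[_ h _]|[_ h _]].
- by left.
- by left; apply: trans_alphabet h.
- by right; apply: trans_alphabet h.
Qed.

Definition par L1 L2 : LTS Act :=
  {| init := (init L1, init L2); trans_alphabet := @par_alphabet L1 L2 |}.

End Operators.

Section Semantics.
Variable Act : Type.
Implicit Types (L : LTS Act).

(* Words in Sigma^* and Sigma^omega are [seq Act] and [nat -> Act]; the labels
   along a path are in the alphabet by [trans_alphabet]. *)
Inductive weak_path L : state L -> seq Act -> state L -> Prop :=
| weak_path_nil s : weak_path s [::] s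
| weak_path_tau s t u sigma :
    trans s None t -> weak_path t sigma u -> weak_path s sigma u
| weak_path_vis s t u a sigma :
    trans s (Some a) t -> weak_path t sigma u -> weak_path s (a :: sigma) u.

Definition diverges L (s : state L) : Prop :=
  exists p : nat -> state L, p 0 = s /\ forall k, trans (p k) None (p k.+1).

(* [g i] is the position of the i-th non-tau label of [l]. *)
Definition visible_word (l : nat -> option Act) (xi : nat -> Act) : Prop :=
  exists g : nat -> nat,
    [/\ forall i j, i < j -> g i < g j,
        forall i, l (g i) = Some (xi i)
      & forall k, (forall i, g i <> k) -> l k = None].

Definition inf_path L (s : state L) (xi : nat -> Act) : Prop :=
  exists (p : nat -> state L) (l : nat -> option Act),
    [/\ p 0 = s, forall k, trans (p k) (l k) (p k.+1) & visible_word l xi].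

Definition Tr L : set (seq Act) :=
  [set sigma | exists s, weak_path (init L) sigma s].

Definition Div L : set (seq Act) :=
  [set sigma | exists2 s, weak_path (init L) sigma s & diverges s].

Definition Inf L : set (nat -> Act) := [set xi | inf_path (init L) xi].

Definition Sf L : set (seq Act * set Act) :=
  [set x | x.2 `<=` alphabet L /\
     exists s, [/\ weak_path (init L) x.1 s,
                   forall s', ~ trans s None s'
                 & forall a, x.2 a -> forall s', ~ trans s (Some a) s']].

Definition minD L : set (seq Act) :=
  [set sigma | Div L sigma /\
     forall i, i < size sigma -> ~ Div L (take i sigma)].

Definition extI L : set (nat -> Act) :=
  [set xi | (forall i, alphabet L (xi i)) /\ exists i, minD L (mkseq xi i)].

Definition anI L : set (nat -> Act) := Inf L `\` extI L.

Definition cffd_eq L L' : Prop :=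
  [/\ alphabet L = alphabet L', Sf L = Sf L', Div L = Div L' & Inf L = Inf L'].

Definition preserves (R : LTS Act -> LTS Act -> Prop) (T : Type) (X : LTS Act -> T) :=
  forall L L', R L L' -> X L = X L'.

Record congruence (R : LTS Act -> LTS Act -> Prop) : Prop := MkCongruence {
  cong_refl : forall L, R L L;
  cong_sym : forall L L', R L L' -> R L' L;
  cong_trans : forall L L' L'', R L L' -> R L' L'' -> R L L'';
  cong_prefix : forall a L L', R L L' -> R (act_prefix a L) (act_prefix a L');
  cong_hide : forall A L L', R L L' -> R (hide L A) (hide L' A);
  cong_rename : forall Phi L L', R L L' -> R (rename L Phi) (rename L' Phi);
  cong_parl : forall L L' L'', R L L' -> R (par L L'') (par L' L'');
  cong_parr : forall L L' L'', R L L' -> R (par L'' L) (par L'' L')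
}.

Definition induced_by_Sigma_Sf_minD_anI L L' : Prop :=
  [/\ alphabet L = alphabet L', Sf L = Sf L', minD L = minD L' & anI L = anI L'].

End Semantics.

(* Main.v *)
(* A congruence that preserves Sf and minD also preserves the alphabet (compose
   b.L in parallel with a deadlock over {b}) and anI: run L against a process
   that can only follow xi and hide everything; the result diverges initially
   iff xi is an infinite trace of L or some finite prefix of xi is in Div(L).

   Conversely, let M and M' be congruent with sigma in Tr(M) but not in Tr(M').
   Following sigma and renaming all actions to b turns them into congruent
   observers, only the first of which can perform b^n, n being the length of
   sigma.  Attach to L an exit that leads from each divergent state, through n
   hidden steps synchronized with the observer, to a state that loops forever on
   the whole alphabet of L.  All states beyond the exit diverge, so Sf is
   unchanged.  If b^n is blocked, the result is CFFD-equivalent to L; if it is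
   possible, Div becomes the set of all extensions of minD(L), and Inf becomes
   anI(L) together with extI(L).  So L is congruent to a process whose CFFD
   semantics depends only on Sigma, Sf, minD and anI. *)
Require Import Defs.
From mathcomp Require Import all_boot.
From mathcomp Require Import boolp classical_sets cardinality.
Local Open Scope classical_set_scope.

Set Implicit Arguments.
Unset Strict Implicit.
Unset Printing Implicit Defensive.

(** * Weak paths, divergence and visible words of infinite paths *)

Section Paths.
Variables (Act : Type) (L : LTS Act).
Implicit Types (s t u : state L) (w v : seq Act) (a : Act) (xi : nat -> Act).

Definition visible (l : option Act) : seq Act := oapp (cons^~ [::]) [::] l.

Lemma weak_path_cat s t u w v :
  weak_path s w t -> weak_path t v u -> weak_path s (w ++ v) u.
Proof.
move=> st; elim: st => //= [{}s s' t' sigma h _ IH|{}s s' t' a sigma h _ IH] tu.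
  exact: weak_path_tau h (IH tu).
exact: weak_path_vis h (IH tu).
Qed.

Lemma weak_path_step s l t : trans s l t -> weak_path s (visible l) t.
Proof.
case: l => [a|] h; first exact: weak_path_vis h (weak_path_nil _).
exact: weak_path_tau h (weak_path_nil _).
Qed.

(** [weak_path] grows at the front, whereas invariants of reachable states are carried along by
    steps at the end. The induction is made to work by generalizing over the word [v] already
    read. *)
Lemma weak_path_ind_r (P : seq Act -> state L -> Prop) s :
  P [::] s ->
  (forall w t l u, P w t -> trans t l u -> P (w ++ visible l) u) ->
  forall w t, weak_path s w t -> P w t.
Proof.
move=> P0 PS w t st.
suff H v : P v s -> P (v ++ w) t by exact: (H [::]).
elim: st v {P0} => [{}s v|{}s s' t' sigma h _ IH v Pv|{}s s' t' a sigma h _ IH v Pv].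
- by rewrite cats0.
- by apply: IH; rewrite -[v]cats0; apply: PS Pv h.
- by rewrite -cat1s catA; apply: IH; apply: PS Pv h.
Qed.

Lemma weak_path_alphabet s w t i x :
  weak_path s w t -> i < size w -> alphabet L (nth x w i).
Proof.
move=> st; elim: st i => //= s1 s2 s3 a sigma h _ IH [|i] /=.
  by move=> _; apply: trans_alphabet h.
exact: IH.
Qed.

Lemma diverges_step s t : trans s None t -> diverges t -> diverges s.
Proof.
move=> st [p [p0 pS]]; exists (fun k => if k is k'.+1 then p k' else s).
by split=> // -[|k] //=; rewrite p0.
Qed.

Lemma weak_path_nil_diverges s t : weak_path s [::] t -> diverges t -> diverges s.
Proof.
move: {-2}[::] (erefl (@nil Act)) => w + st.
elim: st => // s1 s2 s3 sigma h _ IH ws ts.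
exact: diverges_step h (IH ws ts).
Qed.

Lemma Div_nil : Div L [::] <-> diverges (init L).
Proof.
split=> [[s]|]; first exact: weak_path_nil_diverges.
by exists (init L) => //; exact: weak_path_nil.
Qed.

Lemma minD_nil : minD L [::] <-> Div L [::].
Proof. by split=> [[]|]. Qed.

Lemma minD_Div w : minD L w -> Div L w.
Proof. by case. Qed.

(** The shortest divergent prefix is minimal by choice. *)
Lemma Div_take_minD w : Div L w -> exists2 i, i <= size w & minD L (take i w).
Proof.
move=> Dw.
have ex : exists i, `[< Div L (take i w) >].
  by exists (size w); rewrite take_size; apply/asboolP.
case: (ex_minnP ex) => i /asboolP Di i_min; exists i.
  by apply: i_min; rewrite take_size; apply/asboolP.
split=> // j; rewrite size_take_min leq_min => /andP[ji jw]; rewrite take_takel ?(ltnW ji) //.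
by move=> /asboolP /i_min; rewrite leqNgt ji.
Qed.

Lemma Div_mkseq_minD xi i :
  Div L (mkseq xi i) -> exists j, minD L (mkseq xi j).
Proof.
by case/Div_take_minD => j _; rewrite /mkseq -map_take take_iota; exists (minn j i).
Qed.

Lemma inf_path_step s l t xi :
  trans s l t -> inf_path t xi ->
  inf_path s (if l is Some a then fun i => if i is i'.+1 then xi i' else a else xi).
Proof.
move=> st [p [m [p0 pS [g [g_mono g_lab g_none]]]]].
exists (fun k => if k is k'.+1 then p k' else s).
exists (fun k => if k is k'.+1 then m k' else l).
split=> //; first by case=> [|k] //=; rewrite p0.
case: l st => [a|] st.
  exists (fun i => if i is i'.+1 then (g i').+1 else 0); split.
  - by case=> [|i] [|j] //=; rewrite !ltnS; apply: g_mono.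
  - by case.
  - case=> [|k] gk; first by case: (gk 0).
    by apply: g_none => i gi; apply: (gk i.+1); rewrite gi.
exists (fun i => (g i).+1); split=> //.
by case=> // k gk; apply: g_none => i gi; apply: (gk i); rewrite gi.
Qed.

Lemma weak_path_inf_path s t i xi :
  weak_path s (mkseq xi i) t -> inf_path t (fun k => xi (i + k)) -> inf_path s xi.
Proof.
move: {-1}(mkseq xi i) (erefl (mkseq xi i)) => w + st.
elim: st i xi => [{}s|{}s s' t' sigma h _ IH|{}s s' t' a sigma h _ IH] i xi.
- by case: i => // i.
- by move=> ei ti; apply: (inf_path_step h); apply: IH ei ti.
case: i => // i; rewrite /mkseq /= (iotaDl 1 0) -map_comp => -[xi0 xi_w] ti.
have := inf_path_step h (IH i (fun k => xi k.+1) xi_w ti).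
by congr inf_path; apply/funext => -[|k] //=.
Qed.

Lemma visible_word_prefix (l : nat -> option Act) xi k :
  visible_word l xi -> pmap id (mkseq l k) = mkseq xi (size (pmap id (mkseq l k))).
Proof.
move=> [g [g_mono g_lab g_none]].
(* [i] counts the visible positions below [k]; the equivalence records that these are exactly [g 0],
   ..., [g (i - 1)]. *)
suff [i [-> _]] : exists i, pmap id (mkseq l k) = mkseq xi i /\ forall j, j < i <-> g j < k.
  by rewrite size_mkseq.
elim: k => [|k [i [IH gi]]]; first by exists 0; split.
rewrite mkseqS -cats1 pmap_cat IH /=.
have [[j gj]|gk] := pselect (exists j, g j = k); last first.
  have gk' j : g j <> k by move=> gj; apply: gk; exists j.
  exists i; rewrite g_none //= cats0; split=> // j.
  by rewrite ltnS [g j <= k]leq_eqVlt; split=> [/gi ->|/orP[/eqP/gk'|/gi]//]; rewrite orbT.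
(* A visible label at position [k] must be the first one not yet counted. *)
have ji : j = i.
  apply/eqP; rewrite eqn_leq; apply/andP; split; rewrite leqNgt; apply/negP.
    by move=> /g_mono; rewrite gj => /gi; rewrite ltnn.
  by move=> /gi; rewrite gj ltnn.
exists i.+1; rewrite -gj g_lab ji /= mkseqS cats1; split=> // m.
rewrite !ltnS; split; last first.
  by apply: contraTT; rewrite -!ltnNge; apply: g_mono.
by rewrite leq_eqVlt => /orP[/eqP->//|/g_mono/ltnW].
Qed.

Lemma visible_word_label (l : nat -> option Act) xi k a :
  visible_word l xi -> l k = Some a -> a = xi (size (pmap id (mkseq l k))).
Proof.
move=> lxi lk; have := visible_word_prefix k.+1 lxi.
rewrite mkseqS -cats1 pmap_cat lk /= size_cat addn1 mkseqS -cats1.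
(* Reversal brings the last letters of the two words to the front, where they are compared. *)
by rewrite -visible_word_prefix // => /(congr1 rev); rewrite !rev_cat => -[].
Qed.

Lemma visible_word_pos (l : nat -> option Act) xi k :
  visible_word l xi -> exists2 k', k <= k' & exists a, l k' = Some a.
Proof.
move=> [g [g_mono g_lab _]]; exists (g k); last by exists (xi k).
by elim: k => // k IH; apply: leq_ltn_trans IH (g_mono _ _ _).
Qed.

Lemma Div_alphabet w i x : Div L w -> i < size w -> alphabet L (nth x w i).
Proof. by case=> s /weak_path_alphabet h _; apply: h. Qed.

Lemma inf_path_alphabet s xi i : inf_path s xi -> alphabet L (xi i).
Proof. by case=> p [l [_ pS [g [_ gl _]]]]; have := pS (g i); rewrite gl => h; apply: trans_alphabet h. Qed.

End Paths.

(** * Running a process along one fixed infinite word *)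

Section Follow.
Variables (Act : Type) (L : LTS Act) (xi : nat -> Act).
Implicit Types (s : state L) (i : nat) (w : seq Act).

Definition follow_trans (A : set Act) i (l : option Act) j : Prop :=
  [/\ l = Some (xi i), A (xi i) & j = i.+1].

Lemma follow_alphabet A i a j : follow_trans A i (Some a) j -> [set: Act] a.
Proof. by []. Qed.

(* The alphabet is full, so that in a parallel composition [L] cannot perform
   any visible action on its own. *)
Definition follow (A : set Act) : LTS Act :=
  {| init := 0; trans_alphabet := @follow_alphabet A |}.

Definition tracked : LTS Act := par L (follow (alphabet L)).

Lemma tracked_transP s i l s' i' :
  trans (l := tracked) (s, i) l (s', i') <->
  (l = None /\ trans s None s' /\ i' = i) \/
  (l = Some (xi i) /\ trans s l s' /\ i' = i.+1).
Proof.
rewrite /=; split=> [[[a [-> La _ /= sa [[ax] _ ->]]]|[/= nl sl ->]|[/= nl [ll La ->] _]]|].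
- by right; rewrite -ax.
- by case: l nl sl => [a /(_ I)//|_ sl]; left.
- by move: nl; rewrite ll => /(_ La).
move=> [[-> [h ->]]|[-> [h ->]]]; first by constructor 2.
by constructor 1; exists (xi i); have La := trans_alphabet h.
Qed.

Lemma weak_path_tracked s w s' i j :
  weak_path s w s' -> w = mkseq (fun k => xi (i + k)) j ->
  weak_path (L := tracked) (s, i) w (s', i + j).
Proof.
move=> p; elim: p i j => {s w s'} [s|s t u w h _ IH|s t u a w h _ IH] i j.
- by case: j => // _; rewrite addn0; constructor.
- by move=> /IH; apply: weak_path_tau; apply/tracked_transP; left.
case: j => // j; rewrite /mkseq /= (iotaDl 1 0) -map_comp addn0 => -[e ew].
apply: (@weak_path_vis _ tracked _ (t, i.+1)).
  by apply/tracked_transP; right; rewrite -e.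
rewrite addnS -addSn; apply: IH; rewrite ew.
by apply: eq_map => k; rewrite /= addnA addn1.
Qed.

Lemma weak_path_hide_all (M : LTS Act) (c c' : state M) w :
  weak_path c w c' -> weak_path (L := Defs.hide M setT) c [::] c'.
Proof.
elim=> {c w c'} [c|c d e w h _|c d e a w h _]; first by constructor.
  by apply: weak_path_tau; left.
by apply: weak_path_tau; right; exists a.
Qed.

Lemma weak_path_rename_all (M : LTS Act) b (c c' : state M) w :
  weak_path c w c' ->
  weak_path (L := rename M (setT `*` [set b])) c (nseq (size w) b) c'.
Proof.
elim=> {c w c'} [c|c d e w h _|c d e a w h _ IH]; first by constructor.
  exact: weak_path_tau.
by apply: weak_path_vis IH; exists a => //; left.
Qed.

(** The only word of length [i] that [tracked] can perform is the prefix of [xi], so its length,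
    which is all that survives the renaming, still determines it. *)
Lemma Tr_rename_tracked b i :
  Tr (rename tracked (setT `*` [set b])) (nseq i b) <-> Tr L (mkseq xi i).
Proof.
split=> [[c]|[s /weak_path_tracked]]; last first.
  by move=> /(_ 0 i erefl) /(weak_path_rename_all b); rewrite size_mkseq; exists (s, 0 + i).
move=> p; suff [h _] : weak_path (init L) (mkseq xi (size (nseq i b))) c.1 /\
    c.2 = size (nseq i b) by exists c.1; rewrite size_nseq in h.
move: (nseq i b) c p; apply: weak_path_ind_r => [|w [s j] l [t k] [/= p ->]].
  by split=> //; constructor.
case: l => [a [a' /tracked_transP[[]//|[[->] [h ->]]] _]|/tracked_transP[[_ [h ->]]|[]//]].
  rewrite size_cat addn1 mkseqS -cats1; split=> //.
  exact: weak_path_cat p (weak_path_step h).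
rewrite cats0; split=> //; rewrite -[mkseq _ _]cats0.
exact: weak_path_cat p (weak_path_step h).
Qed.

Lemma alphabet_rename_tracked b :
  alphabet (rename tracked (setT `*` [set b])) = [set b].
Proof.
apply/seteqP; split=> [c [a _ []]|c ->]; first by case.
  by case=> _ []; exists b.
by exists b; [right | left].
Qed.

(** Along a hidden infinite run the counter never decreases. If it is unbounded, the run performs
    all of [xi]; if it is bounded, it is eventually constant and [L] diverges from there. *)
Lemma diverges_hide_tracked :
  diverges (init (Defs.hide tracked setT)) <->
  Inf L xi \/ exists i, Div L (mkseq xi i).
Proof.
split=> [[p [p0 pS]]|[[p [l [p0 pS lxi]]]|[i [s /weak_path_tracked]]]]; last first.
- move=> /(_ 0 i erefl) /weak_path_hide_all h [q [q0 qS]].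
  apply: weak_path_nil_diverges h _; exists (fun k => (q k, 0 + i)); rewrite q0; split=> // k.
  by left; apply/tracked_transP; left.
- exists (fun k => (p k, size (pmap id (mkseq l k)))); rewrite p0; split=> // k.
  rewrite mkseqS -cats1 pmap_cat size_cat.
  case lk: (l k) (pS k) => [a|] h /=; last by left; apply/tracked_transP; left; rewrite addn0.
  right; exists a => //; apply/tracked_transP; right.
  by rewrite addn1 -(visible_word_label lxi lk).
have step k : (trans (p k).1 None (p k.+1).1 /\ (p k.+1).2 = (p k).2) \/
    (trans (p k).1 (Some (xi (p k).2)) (p k.+1).1 /\ (p k.+1).2 = (p k).2.+1).
  move: (p k) (p k.+1) (pS k) => [s i] [s' i'] /= [|[a _]] /tracked_transP[[e []]|[e []]] //.
  - by left.
  - by rewrite e; right.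
have path k : weak_path (init L) (mkseq xi (p k).2) (p k).1.
  elim: k => [|k IH]; first by rewrite p0; constructor.
  case: (step k) => -[h ->].
    by rewrite -[mkseq _ _]cats0; apply: weak_path_cat IH (weak_path_step h).
  by rewrite mkseqS -cats1; apply: weak_path_cat IH (weak_path_step h).
have mono i j : i <= j -> (p i).2 <= (p j).2.
  elim: j => [|j IH]; first by rewrite leqn0 => /eqP ->.
  rewrite leq_eqVlt => /orP[/eqP->//|/IH ij].
  by apply: leq_trans ij _; case: (step j) => -[_ ->].
have [unb|/existsNP[i bnd]] := pselect (forall i, exists k, i < (p k).2); [left|right].
  (* The step that raises the counter from [i] is the position of the [i]-th visible label. It ends
     in the first state whose counter exceeds [i]. *)
  have cross i : exists k, (p k).2 = i /\ (p k.+1).2 = i.+1.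
    case: (ex_minnP (unb i)) => -[|k]; first by rewrite p0.
    move=> ik /(_ k); case: ltnP => [_ /(_ isT)|ki _]; first by rewrite ltnn.
    exists k; case: (step k) ik => -[_ ->]; first by rewrite ltnNge ki.
    by rewrite ltnS => ik; have /eqP -> : (p k).2 == i by rewrite eqn_leq ki ik.
  have [g gP] := choice cross.
  exists (fun k => (p k).1).
  exists (fun k => if (p k.+1).2 == (p k).2 then None else Some (xi (p k).2)).
  split=> [|k|]; first by rewrite p0.
    by case: (step k) => -[h ->]; rewrite ?eqxx // gtn_eqF.
  exists g; split=> [i j|i|k gk].
  - by rewrite !ltnNge; apply: contra => /mono; rewrite (gP i).1 (gP j).1.
  - by rewrite (gP i).1 (gP i).2 gtn_eqF.
  case: eqP => // pk.
  have pkS : (p k.+1).2 = (p k).2.+1 by case: (step k) => -[].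
  case: (gk (p k).2); have [gp gpS] := gP (p k).2.
  apply/eqP; rewrite eqn_leq; apply/andP; split; rewrite leqNgt; apply/negP => /mono.
    by rewrite pkS gp ltnn.
  by rewrite gpS ltnn.
(* Once the bounded counter reaches its maximum [m] it stays there, so all later steps are tau steps
   of [L]. *)
have ex : exists j, `[< exists k, (p k).2 = j >].
  by exists (p 0).2; apply/asboolP; exists 0.
have ubound j : `[< exists k, (p k).2 = j >] -> j <= i.
  by move=> /asboolP[k <-]; rewrite leqNgt; apply/negP => ik; apply: bnd; exists k.
case: (ex_maxnP ex ubound) => m /asboolP[k km] max_m; exists m.
have const j : (p (k + j)).2 = m.
  apply/eqP; rewrite eqn_leq -{2}km mono ?leq_addr // andbT.
  by apply: max_m; apply/asboolP; exists (k + j).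
exists (p k).1; first by rewrite -km.
exists (fun j => (p (k + j)).1); rewrite addn0; split=> // j; rewrite addnS.
case: (step (k + j)) => -[] //; rewrite -addnS !const => _ /eqP.
by rewrite ltn_eqF.
Qed.

End Follow.

(** * The gated process: an exit from divergent states, controlled by an observer *)

Section Gate.
Variables (Act : Type) (b : Act) (f : Act -> Act) (n : nat) (L : LTS Act).
Hypotheses (f_inj : injective f) (fb : forall a, f a <> b).

(* [inl] states are those of [L], with its actions coded by [f] so that they
   differ from [b]; [inr k] waits for [k] more [b]s from the observer. *)
Definition gate_trans (y : state L + nat) (l : option Act) (y' : state L + nat) : Prop :=
  match y, l, y' with
  | inl s, None, inl s' => trans s None s'
  | inl s, Some c, inl s' => exists2 a, c = f a & trans s (Some a) s'
  | inl s, Some c, inr k => [/\ c = b, diverges s & k = n]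
  | inr k, None, inr k' => k' = k
  | inr k, Some c, inr k' =>
      (c = b /\ k = k'.+1) \/ (exists2 a, c = f a & [/\ alphabet L a, k = 0 & k' = 0])
  | _, _, _ => False
  end.

Lemma gate_alphabet y c y' :
  gate_trans y (Some c) y' -> (f @` alphabet L `|` [set b]) c.
Proof.
case: y y' => [s|k] [s'|k'] //=.
- by move=> [a -> h]; left; exists a => //; apply: trans_alphabet h.
- by move=> [-> _ _]; right.
- by move=> [[-> _]|[a -> [La _ _]]]; [right|left; exists a].
Qed.

Definition gate : LTS Act := {| init := inl (init L); trans_alphabet := gate_alphabet |}.

Variable X : LTS Act.
Hypothesis X_alphabet : alphabet X = [set b].

Definition decode : set (Act * Act) := [set ab | ab.1 = f ab.2].

(* The prefix [b] keeps the observer [X] inactive until a divergent state of [L]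
   is left. *)
Definition gated : LTS Act :=
  rename (Defs.hide (par (act_prefix b X) gate) [set b]) decode.

Lemma decodes_f a a' : renames decode (f a) a' <-> a = a'.
Proof.
split=> [[/f_inj//|[_ []]]|->]; last by left.
by exists a.
Qed.

Lemma gated_alphabet : alphabet gated = alphabet L.
Proof.
apply/seteqP; split=> [a [c [/= + cb]]|a La] /=.
  rewrite X_alphabet => -[[]|[[a' La' <-]|]] //.
  by move=> /decodes_f <-.
exists (f a); last by left.
by split=> [|/fb//]; right; left; exists a.
Qed.

(** Transitions between the states that can be reached, with hiding and decoding already carried
    out. [step_idle] comes from the tau loop of the gate and makes every state beyond the exit
    divergent. *)
Inductive gated_step : state gated -> option Act -> state gated -> Prop :=
| step_L s l s' : trans s l s' -> gated_step (None, inl s) l (None, inl s')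
| step_open s : diverges s -> gated_step (None, inl s) None (Some (init X), inr n)
| step_idle x k : gated_step (Some x, inr k) None (Some x, inr k)
| step_X x x' k :
    trans x None x' -> gated_step (Some x, inr k) None (Some x', inr k)
| step_count x x' k :
    trans x (Some b) x' -> gated_step (Some x, inr k.+1) None (Some x', inr k)
| step_run x a :
    alphabet L a -> gated_step (Some x, inr 0) (Some a) (Some x, inr 0).

Lemma gated_step_trans c l c' : gated_step c l c' -> trans c l c'.
Proof.
case=> {c l c'} [s l s' h|s h|x k|x x' k h|x x' k h|x a La].
- case: l h => [a|] h /=; last by left; constructor 3.
  exists (f a); last by apply/decodes_f.
  split; first exact: fb.
  constructor 3; split=> //=; last by exists a.
  by rewrite X_alphabet => -[]/fb.
- right; exists b => //; constructor 1; exists b; split=> //=.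
  + by right.
  + by right.
- by left; constructor 3.
- by left; constructor 2.
- right; exists b => //; constructor 1; exists b; split=> //=.
  + by right.
  + by right.
  + by left.
- exists (f a); last by apply/decodes_f.
  split; first exact: fb.
  constructor 3; split=> //=; last by right; exists a.
  by rewrite X_alphabet => -[]/fb.
Qed.

(** The first [b] is shared and moves the prefix and the gate at once, so mixed pairs are never
    reached. *)
Definition closed_or_open (c : state gated) : bool :=
  match c with (None, inl _) | (Some _, inr _) => true | _ => false end.

Lemma par_gate_trans_b c c' :
  closed_or_open c -> par_trans (L1 := act_prefix b X) (L2 := gate) c (Some b) c' ->
  gated_step c None c'.
Proof.
move: c c' => [[x|] [s|k]] [[x'|] [s'|k']] // _ [[a [[<-] _ _]]|[nl]|[nl]] /=;
  try by [case: nl; right | case | move=> _ []].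
- by move=> h [[_ ->]|[a' /esym/fb]] //; constructor.
- by move=> _ [a' /esym/fb].
- by move=> [_ ->] [_ h ->]; constructor.
Qed.

Lemma par_gate_trans_tau c c' :
  closed_or_open c -> par_trans (L1 := act_prefix b X) (L2 := gate) c None c' ->
  gated_step c None c'.
Proof.
move: c c' => [[x|] [s|k]] [[x'|] [s'|k']] // _ [[a []]//|[_ /=]|[_ /=]] //.
- by move=> h [->]; constructor.
- by move=> -> [->]; constructor.
- by case.
- by move=> h _; constructor.
Qed.

(** An action other than [b] is outside the alphabet of the observer, so only the gate can perform
    it. *)
Lemma par_gate_trans_vis c c' d a :
  closed_or_open c -> d <> b -> renames decode d a ->
  par_trans (L1 := act_prefix b X) (L2 := gate) c (Some d) c' ->
  gated_step c (Some a) c'.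
Proof.
move=> + db da; have no_shared : ~ alphabet (act_prefix b X) d by rewrite /= X_alphabet => -[].
move=> + [[d' [[<-] /no_shared]]//|[_ h]|[_]].
  by case: no_shared; apply: trans_alphabet h.
move: c c' => [[x|] [s|k]] [[x'|] [s'|k']] // _ /= //.
- move=> [[/db]//|[a' dE [La -> ->]]] [->].
  by move: da; rewrite dE => /decodes_f <-; constructor.
- by move=> [a' dE h] _; move: da; rewrite dE => /decodes_f <-; constructor.
- by case=> /db.
Qed.

Lemma gated_transP c l c' :
  closed_or_open c -> trans (l := gated) c l c' <-> gated_step c l c'.
Proof.
move=> cc; split; last exact: gated_step_trans.
case: l => [a [d [db h] /par_gate_trans_vis]|[/par_gate_trans_tau|[_ -> /par_gate_trans_b]]];
  by apply.
Qed.

Lemma gated_trans_closed s l c' :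
  trans (l := gated) (None, inl s) l c' ->
  (exists2 s', c' = (None, inl s') & trans s l s') \/
  [/\ diverges s, l = None & c' = (Some (init X), inr n)].
Proof.
move=> /gated_transP -/(_ isT) h.
by inversion h; subst; [left; eexists | right].
Qed.

Lemma gated_trans_open x k l c' :
  trans (l := gated) (Some x, inr k) l c' ->
  (exists x' k', c' = (Some x', inr k')) /\ (l <> None -> k = 0).
Proof.
move=> /gated_transP -/(_ isT) h.
by inversion h; subst; split=> //; eexists; eexists.
Qed.

(** * Reachable states and semantics of the gated process *)

Definition div_take (w : seq Act) : Prop := exists2 i, i <= size w & Div L (take i w).

(** Beyond the exit the observer has done [m] of the [n] required steps. While [k] is positive
    nothing visible has happened since the exit, so [w] itself is divergent; afterwards only some
    prefix of [w] need be. *)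
Definition gated_inv (w : seq Act) (c : state gated) : Prop :=
  match c with
  | (None, inl s) => weak_path (init L) w s
  | (Some x, inr k) =>
      [/\ k = 0 \/ Div L w, div_take w &
          exists2 m, m + k = n & weak_path (init X) (nseq m b) x]
  | _ => False
  end.

Lemma gated_inv_shape w c : gated_inv w c -> closed_or_open c.
Proof. by case: c => [[x|] [s|k]]. Qed.

Lemma gated_inv_init : gated_inv [::] (init gated).
Proof. exact: weak_path_nil. Qed.

Lemma gated_inv_step w c l c' :
  gated_inv w c -> trans c l c' -> gated_inv (w ++ visible l) c'.
Proof.
move=> inv /(gated_transP _ _ (gated_inv_shape inv)) tr.
case: tr inv => {c l c'} [s l s' h|s h|x k|x x' k h|x x' k h|x a La] /=.
- by move=> p; apply: weak_path_cat p (weak_path_step h).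
- move=> p; rewrite cats0; have Dw : Div L w by exists s.
  split; [by right | by exists (size w); rewrite ?take_size|].
  by exists 0 => //; constructor.
- by rewrite cats0.
- rewrite cats0 => -[kw Dw [m mk p]]; split=> //; exists m => //.
  by rewrite -[nseq _ _]cats0; apply: weak_path_cat p (weak_path_step h).
- rewrite cats0 => -[[]// kw Dw [m mk p]]; split; [by right| by []|].
  exists m.+1; first by rewrite addSnnS.
  by rewrite -addn1 nseqD; apply: weak_path_cat p (weak_path_step h).
- move=> [_ [i iw Di] mP]; split; [by left| |by []].
  by exists i; rewrite ?takel_cat // size_cat (leq_trans iw) ?leq_addr.
Qed.

Lemma gated_inv_path w c : weak_path (init gated) w c -> gated_inv w c.
Proof.
move: w c; apply: weak_path_ind_r => [|w c l c' IH h]; first exact: gated_inv_init.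
exact: gated_inv_step IH h.
Qed.

Lemma gated_path_L s w s' :
  weak_path s w s' -> weak_path (L := gated) (None, inl s) w (None, inl s').
Proof.
elim=> {s w s'} [s|s t u w h _|s t u a w h _]; first by constructor.
  by apply: weak_path_tau; apply: gated_step_trans; constructor.
by apply: weak_path_vis; apply: gated_step_trans; constructor.
Qed.

Lemma gated_path_X x w x' k :
  weak_path x w x' -> w = nseq k b ->
  weak_path (L := gated) (Some x, inr k) [::] (Some x', inr 0).
Proof.
move=> p; elim: p k => {x w x'} [x|x y z w h _ IH|x y z a w h _ IH] k.
- by case: k => // _; constructor.
- by move=> /IH; apply: weak_path_tau; apply: gated_step_trans; constructor.
case: k => //= k [e /IH]; apply: weak_path_tau; apply: gated_step_trans.
by constructor; rewrite -e.
Qed.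

Lemma gated_path_open w :
  Tr X (nseq n b) -> Div L w ->
  exists x, weak_path (init gated) w (Some x, inr 0).
Proof.
move=> [x /gated_path_X /(_ erefl) p] [s /gated_path_L ps ds]; exists x.
rewrite -[w]cats0; apply: weak_path_cat ps _.
by apply: weak_path_tau p; apply: gated_step_trans; constructor.
Qed.

Lemma gated_path_run x v :
  (forall i y, i < size v -> alphabet L (nth y v i)) ->
  weak_path (L := gated) (Some x, inr 0) v (Some x, inr 0).
Proof.
elim: v => [|a v IH] Lv; first by constructor.
apply: (@weak_path_vis _ gated _ (Some x, inr 0)).
  by apply: gated_step_trans; constructor; apply: (Lv 0 a).
by apply: IH => i y; apply: (Lv i.+1).
Qed.

(** States beyond the exit have a tau loop and are never stable. A stable state of [L] does not
    diverge, so the exit gives it no new tau step. *)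
Lemma Sf_gated : Sf gated = Sf L.
Proof.
apply/seteqP; split=> -[w A] [LA [c []]].
  move: c => [[x|] [s|k]] /gated_inv_path // p st_tau st_A.
    by case: (st_tau (Some x, inr k)); apply: gated_step_trans; constructor.
  rewrite gated_alphabet in LA; split=> //; exists s; split=> // [s' h|a Aa s' h].
    by apply: (st_tau (None, inl s')); apply: gated_step_trans; constructor.
  by apply: (st_A a Aa (None, inl s')); apply: gated_step_trans; constructor.
move=> /gated_path_L p st_tau st_A; split; first by rewrite gated_alphabet.
exists (None, inl c); split=> //.
  move=> c' /gated_trans_closed[[s' _ /st_tau]//|[[q [q0 qS]] _ _]].
  by have := qS 0; rewrite q0 => /st_tau.
by move=> a Aa c' /gated_trans_closed[[s' _ /(st_A _ Aa)]|[]].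
Qed.

(** Completing the count leads to a state that diverges and accepts every word over the alphabet,
    which adds all extensions of divergent traces. A run stuck in the count diverges only after a
    trace that was divergent in [L] already. *)
Lemma Div_gated w :
  Div gated w <->
  Div L w \/ [/\ Tr X (nseq n b),
                forall i y, i < size w -> alphabet L (nth y w i)
              & div_take w].
Proof.
split.
  move=> [c p [q [q0 qS]]].
  have Lw i y : i < size w -> alphabet L (nth y w i).
    by rewrite -gated_alphabet; apply: weak_path_alphabet p.
  have inv k : gated_inv w (q k).
    elim: k => [|k IH]; first by rewrite q0; apply: gated_inv_path.
    by rewrite -[w]cats0; apply: gated_inv_step IH (qS k).
  (* Either the run passes the exit at some time, or it stays inside [L] throughout. *)
  have [[k [x [j qk]]]|no_open] := pselect (exists k x j, q k = (Some x, inr j)).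
    have := inv k; rewrite qk => -[[j0|Dw] Dt [m mj px]]; last by left.
    by right; split=> //; exists x; rewrite -mj j0 addn0.
  have closed k : exists s, q k = (None, inl s).
    move: (inv k) (no_open); case qk: (q k) => [[x|] [s|j]] // _.
      by case; exists k, x, j.
    by exists s.
  have [r rP] := choice closed; left; exists (r 0).
    by have := inv 0; rewrite rP.
  exists r; split=> // k; have := qS k; rewrite !rP => /gated_trans_closed.
  by case=> [[s' [->]]|[]].
move=> [[s /gated_path_L p [q [q0 qS]]]|[Xn Lw [i iw /(gated_path_open Xn)[x p]]]].
  exists (None, inl s) => //; exists (fun k => (None, inl (q k))); rewrite q0; split=> // k.
  by apply: gated_step_trans; constructor.
exists (Some x, inr 0); last first.
  exists (fun=> (Some x, inr 0)); split=> // k.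
  by apply: gated_step_trans; constructor.
rewrite -[w](cat_take_drop i); apply: weak_path_cat p _.
apply: gated_path_run => j y; rewrite size_drop nth_drop ltn_subRL.
exact: Lw.
Qed.

Lemma Inf_gated xi :
  Inf gated xi <->
  Inf L xi \/ [/\ Tr X (nseq n b), forall i, alphabet L (xi i)
               & exists i, Div L (mkseq xi i)].
Proof.
split.
  move=> ixi; have Lxi i : alphabet L (xi i).
    by rewrite -gated_alphabet; apply: inf_path_alphabet ixi.
  case: ixi => q [l [q0 qS lxi]].
  have inv k : gated_inv (pmap id (mkseq l k)) (q k).
    elim: k => [|k IH]; first by rewrite q0; apply: gated_inv_init.
    by rewrite mkseqS -cats1 pmap_cat; have := gated_inv_step IH (qS k); case: (l k).
  have [[k [x [j qk]]]|no_open] := pselect (exists k x j, q k = (Some x, inr j)).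
    right.
    have opened m : exists x' j', q (k + m) = (Some x', inr j').
      elim: m => [|m [x' [j' qm]]]; first by exists x, j; rewrite addn0.
      have := qS (k + m); by rewrite qm addnS => /gated_trans_open[].
    (* An infinite word has a visible label after the exit was taken. Visible actions there require
       the count to be 0, so the observer has completed its [n] steps. *)
    have [m' /subnKC <- [a la]] := visible_word_pos k lxi.
    set m := m' - k in la *.
    have := qS (k + m); have := inv (k + m); have [x' [j' ->]] := opened m.
    rewrite la => -[_ [i iw Di] [t tj px]] /gated_trans_open[_ j0].
    split=> //; first by exists x'; rewrite -tj j0 ?addn0.
    exists i; move: Di iw; rewrite (visible_word_prefix _ lxi) size_mkseq.
    by rewrite /mkseq -map_take take_iota => Di iw; rewrite -(minn_idPl iw).
  have closed k : exists s, q k = (None, inl s).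
    move: (inv k) (no_open); case qk: (q k) => [[x|] [s|j]] // _.
      by case; exists k, x, j.
    by exists s.
  have [r rP] := choice closed; left; exists r, l; split=> //.
    by have := q0; rewrite rP => -[].
  move=> k; have := qS k; rewrite !rP => /gated_trans_closed.
  by case=> [[s' [->]]|[]].
move=> [[q [l [q0 qS lxi]]]|[Xn Lxi [i /(gated_path_open Xn)[x p]]]].
  exists (fun k => (None, inl (q k))), l; rewrite q0; split=> // k.
  by apply: gated_step_trans; constructor.
apply: weak_path_inf_path p _.
exists (fun=> (Some x, inr 0)), (fun k => Some (xi (i + k))); split=> // [k|].
  by apply: gated_step_trans; constructor.
by exists id; split=> // k /(_ k).
Qed.

Lemma Div_gated_blocked : ~ Tr X (nseq n b) -> Div gated = Div L.
Proof.
move=> nX; apply/seteqP; split=> w; last by move=> Dw; apply/Div_gated; left.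
by move=> /Div_gated[|[]].
Qed.

Lemma Inf_gated_blocked : ~ Tr X (nseq n b) -> Inf gated = Inf L.
Proof.
move=> nX; apply/seteqP; split=> xi; last by move=> Ixi; apply/Inf_gated; left.
by move=> /Inf_gated[|[]].
Qed.

(** Divergent prefixes can be shortened to minimal ones, so the right-hand side involves only the
    alphabet and [minD]. *)
Lemma Div_gated_passed :
  Tr X (nseq n b) ->
  Div gated = [set w | (forall i y, i < size w -> alphabet L (nth y w i)) /\
                       exists2 i, i <= size w & minD L (take i w)].
Proof.
move=> Xn; apply/seteqP; split=> w.
  move=> /Div_gated[Dw|[_ Lw [i iw /Div_take_minD[j]]]].
    by split; [move=> i y; apply: Div_alphabet | apply: Div_take_minD].
  rewrite size_takel // => ji; rewrite take_takel // => Dj.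
  by split=> //; exists j => //; apply: leq_trans ji iw.
by case=> Lw [i iw /minD_Div Di]; apply/Div_gated; right; split=> //; exists i.
Qed.

Lemma Inf_gated_passed : Tr X (nseq n b) -> Inf gated = anI L `|` extI L.
Proof.
move=> Xn; apply/seteqP; split=> xi.
  move=> /Inf_gated[Lxi|[_ Lxi [i /Div_mkseq_minD Dj]]]; last by right.
  by have [|nE] := pselect (extI L xi); [right | left].
by case=> [[Lxi _]|[Lxi [i /minD_Div Di]]]; apply/Inf_gated; [left | right; split=> //; exists i].
Qed.

End Gate.

(* [f] shifts an injective sequence in [T] by one and fixes everything else. *)
Lemma infinite_avoiding_injection (T : Type) :
  infinite_set [set: T] -> exists b (f : T -> T), injective f /\ forall a, f a <> b.
Proof.
elim/Ppointed: T => T; first by move=> /infinite_setN0[a _]; case: (no a).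
move=> /infiniteP/pcard_injP[g g_inj0].
have g_inj : injective g by move=> i j /g_inj0; apply; apply: in_setT.
exists (g 0); exists (fun a => if pselect (exists i, a = g i) is left h
  then g (projT1 (cid h)).+1 else a); split=> [a a'|a].
  case: pselect => [h|h]; case: pselect => [h'|h'].
  - by case: cid => i /= ->; case: cid => j /= -> /g_inj[->].
  - by move=> e; case: h'; rewrite -e; eexists.
  - by move=> e; case: h; rewrite e; eexists.
  - by [].
case: pselect => [h /g_inj//|h e]; by apply: h; exists 0.
Qed.

(** * Congruences that preserve [Sf] and [minD] *)

Section Congruence.
Variable Act : Type.
Implicit Types (L M : LTS Act) (b : Act).

Definition deadlock (A : set Act) : LTS Act :=
  @MkLTS Act unit A (fun _ _ _ => False) tt (fun _ _ _ => False_ind _).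

(** The deadlock blocks the initial [b], so everything is refused. As refusal sets lie within the
    alphabet, [Sf] of this context reveals the alphabet of [L]. *)
Lemma Sf_prefix_deadlock b L :
  Sf (par (act_prefix b L) (deadlock [set b])) ([::], alphabet L).
Proof.
split=> [a La|]; first by left; left.
exists (None, tt); split=> [|[[s|] []]|a _ [[s|] []]]; first exact: weak_path_nil.
- by case=> [[? []]//|[_ /= []]//|[]].
- by case=> [[? []]//|[_ /= []]//|[]].
- by case=> [[? [_ _ _ _ []]]|[/= nb [[ab]] _ _]|[_ []]]; case: nb.
- by case=> [[? [_ _ _ _ []]]|[_ []]|[_ []]].
Qed.

Variable R : LTS Act -> LTS Act -> Prop.
Hypotheses (R_cong : congruence R) (R_cffd : forall L L', cffd_eq L L' -> R L L').
Hypotheses (R_Sf : preserves R (@Sf Act)) (R_minD : preserves R (@minD Act)).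
Hypothesis Act_infinite : infinite_set [set: Act].

Lemma preserves_alphabet : preserves R (@alphabet Act).
Proof.
suff H L L' : R L L' -> alphabet L `<=` alphabet L'.
  by move=> L L' LL'; apply/seteqP; split; apply: H => //; apply: cong_sym.
move=> LL' a La.
(* The prefix adds [b] to the alphabet; choosing [b] different from [a] ensures that [a] can only
   come from [L']. *)
have [b ba] : exists b, a <> b.
  have [b [f [_ fb]]] := infinite_avoiding_injection Act_infinite.
  have [->|ab] := pselect (a = b); last by exists b.
  by exists (f b) => /esym/fb.
have := Sf_prefix_deadlock b L.
rewrite (R_Sf (cong_parl R_cong _ (cong_prefix R_cong b LL'))) => -[/(_ a La)].
by case=> [[//|/ba]|/ba].
Qed.

Lemma extI_eq L L' : alphabet L = alphabet L' -> minD L = minD L' -> extI L = extI L'.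
Proof. by rewrite /extI => -> ->. Qed.

Lemma preserves_anI : preserves R (@anI Act).
Proof.
suff H L L' : R L L' -> anI L `<=` anI L'.
  by move=> L L' LL'; apply/seteqP; split; apply: H => //; apply: cong_sym.
move=> LL' xi [Lxi nexti].
have eA := preserves_alphabet LL'; have eD := R_minD LL'.
have eE := extI_eq eA eD.
split; last by rewrite -eE.
have : minD (Defs.hide (tracked L xi) [set: Act]) [::].
  by apply/minD_nil/Div_nil/diverges_hide_tracked; left.
rewrite (R_minD (cong_hide R_cong _ (cong_parl R_cong _ LL'))) eA.
(* The divergence on the side of [L'] may also stem from a divergent prefix of [xi]; as [minD]
   agrees, this would put [xi] into [extI L]. *)
move=> /minD_nil/Div_nil/diverges_hide_tracked[//|[i /Div_mkseq_minD[j Dj]]].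
case: nexti; split; last by exists j; rewrite eD.
by move=> k; apply: inf_path_alphabet Lxi.
Qed.

(** * Exploiting a trace that the congruence does not preserve *)

Hypothesis R_not_Tr : ~ preserves R (@Tr Act).

Lemma Tr_separated : exists M M' sigma, [/\ R M M', Tr M sigma & ~ Tr M' sigma].
Proof.
apply: contrapT => no; apply: R_not_Tr => M M' MM'.
suff H N N' : R N N' -> Tr N `<=` Tr N'.
  by apply/seteqP; split; apply: H => //; apply: cong_sym.
move=> NN' sigma Ns; apply: contrapT => N's; apply: no.
by exists N, N', sigma.
Qed.

Lemma induced_by_R L L' : induced_by_Sigma_Sf_minD_anI L L' -> R L L'.
Proof.
move=> [eA eS eD eI].
have [b [f [f_inj fb]]] := infinite_avoiding_injection Act_infinite.
have [M [M' [sigma [MM' Ms M's]]]] := Tr_separated.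
(* Only the first [n] values of [xi] matter; the default [b] merely pads [sigma] to an infinite
   word. *)
pose n := size sigma; pose xi := nth b sigma.
(* The follower is built from the alphabet of [M] for every [N], so that [obs] is one fixed context
   and preserves [R]. *)
pose obs N := rename (par N (follow xi (alphabet M))) (setT `*` [set b]).
have obs_tracked N : R M N -> obs N = rename (tracked N xi) (setT `*` [set b]).
  by move=> /preserves_alphabet eN; rewrite /tracked -eN.
have obs_A N : R M N -> alphabet (obs N) = [set b].
  by move=> MN; rewrite obs_tracked // alphabet_rename_tracked.
have obs_Tr N : R M N -> Tr (obs N) (nseq n b) <-> Tr N sigma.
  by move=> MN; rewrite obs_tracked // Tr_rename_tracked mkseq_nth.
have MM := cong_refl R_cong M.
have obsT : Tr (obs M) (nseq n b) by apply/(obs_Tr _ MM).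
have obsF : ~ Tr (obs M') (nseq n b) by move/(obs_Tr _ MM').
have obs_alpha := obs_A _ MM; have obs_alpha' := obs_A _ MM'.
have stay K : R (gated b f n K (obs M')) K.
  apply: R_cffd; split; [exact: gated_alphabet | exact: Sf_gated | |].
    exact: Div_gated_blocked.
  exact: Inf_gated_blocked.
have switch K : R (gated b f n K (obs M)) (gated b f n K (obs M')).
  by do ![apply: cong_rename|apply: cong_hide|apply: cong_parl|apply: cong_prefix].
(* With the exit open, the two gated processes are CFFD-equivalent, since the remaining differences
   in [Div] and [Inf] are absorbed by extensions of [minD]. *)
have merge : R (gated b f n L (obs M)) (gated b f n L' (obs M)).
  apply: R_cffd; split; rewrite ?gated_alphabet ?Sf_gated //.
    by rewrite !Div_gated_passed // eA eD.
  by rewrite !Inf_gated_passed // eI (extI_eq eA eD).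
have link K : R (gated b f n K (obs M)) K := cong_trans R_cong (switch K) (stay K).
have trans := cong_trans R_cong.
exact: trans (trans _ _ _ (cong_sym R_cong (link L)) merge) (link L').
Qed.

End Congruence.

Unset Implicit Arguments.

Theorem theorem6p7 (Act : Type) (Act_infinite : infinite_set [set: Act])
    (R : LTS Act -> LTS Act -> Prop)
    (R_congruence : congruence R)
    (R_cffd : forall L L' : LTS Act, cffd_eq L L' -> R L L')
    (R_Sf : preserves R (@Sf Act))
    (R_minD : preserves R (@minD Act))
    (R_not_Tr : ~ preserves R (@Tr Act)) :
  forall L L' : LTS Act, R L L' <-> induced_by_Sigma_Sf_minD_anI L L'.
Proof.
move=> L L'; split=> [LL'|]; last exact: induced_by_R.
split; [exact: preserves_alphabet LL' | exact: R_Sf | exact: R_minD |].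
exact: preserves_anI LL'.
Qed.
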